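(* Let $\mathcal{C}:[0,1]\to\mathbb{R}^3$ be a compact, regular, $C^2$, simple, parametric space curve. Let $\{L_i\}_{i=1}^{\infty}$ be a sequence of PL curves inscribed in $\mathcal{C}$ that converges pointwise to $\mathcal{C}$ and uniformly converges to $\mathcal{C}$ in total curvature. Then there exists a positive integer $N$ such that for all $i>N$, $L_i$ is ambient isotopic to $\mathcal{C}$.
   Context: Curves. All curves are continuous maps $[0,1]\to\mathbb{R}^3$. A curve $\gamma$ is closed if $\gamma(0)=\gamma(1)$, and open otherwise. A curve is simple if it is injective on $[0,1]$ (open case), or injective on $[0,1)$ with $\gamma(0)=\gamma(1)$ (closed case). Regular means that the derivative never vanishes. A closed curve is called regular and $C^2$ if its periodic extension is. For $[a,b]\subset[0,1]$, $\gamma_{[a,b]}$ is the sub-curve obtained by restricting $\gamma$ to $[a,b]$. Inscribed PL curves. A PL curve $L$ is inscribed in $\mathcal{C}$ if there are parameters $0=t_0<t_1<\dots<t_m=1$ such that the vertices of $L$ are $v_j=\mathcal{C}(t_j)$, $0\le j\le m$. It is parametrized on $[0,1]$ by $L(t_j)=v_j$ and by linear interpolation on each $[t_{j-1},t_j]$. Consecutive vertices are distinct. Total curvature. The exterior angle between two nonzero vectors $\vec v_1,\vec v_2$ is the angle in $[0,\pi]$ between them. The exterior angle of a PL curve at a vertex is the angle between the incoming and outgoing oriented edges. The total curvature $T_\kappa$ of a PL curve is the sum of its exterior angles at its interior vertices and, if the curve is closed, also at the closing point. The total curvature of a regular $C^2$ curve is $\int|\kappa(s)|\,ds$, with $s$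 arc length and $\kappa$ the curvature. Convergence. $\{L_i\}$ converges pointwise to $\mathcal{C}$ if $L_i(t)\to\mathcal{C}(t)$ for every $t\in[0,1]$. $\{L_i\}$ uniformly converges to $\mathcal{C}$ in total curvature if for every $[t_1,t_2]\subset[0,1]$ and every $\epsilon>0$ there is an integer $N$ such that $|T_\kappa(L_{i[t_1,t_2]})-T_\kappa(\mathcal{C}_{[t_1,t_2]})|<\epsilon$ for all $i\ge N$, where $L_{i[t_1,t_2]}$ is the sub-curve of $L_i$ over $[t_1,t_2]$. Two curves are ambient isotopic if there is a continuous $H:\mathbb{R}^3\times[0,1]\to\mathbb{R}^3$ with each $H(\cdot,s)$ a homeomorphism, $H(\cdot,0)=\mathrm{id}$, and $H(\cdot,1)$ carrying the image of one curve onto the image of the other. *)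

(* Defs.v *)
From mathcomp Require Import all_boot all_order all_algebra.
From mathcomp Require Import all_classical all_reals all_analysis.
Import Order.TTheory GRing.Theory Num.Theory.
Import numFieldNormedType.Exports.

Set Implicit Arguments.
Unset Strict Implicit.
Unset Printing Implicit Defensive.

Local Open Scope classical_set_scope.
Local Open Scope ring_scope.

(* The topology on ['rV[R]_3] is the library's (sup norm, i.e. the usual
   topology of R^3); lengths and angles are Euclidean. *)

Definition dotp (R : realType) (u v : 'rV[R]_3) : R :=
  \sum_(i < 3) u ord0 i * v ord0 i.

Definition enorm (R : realType) (u : 'rV[R]_3) : R := Num.sqrt (dotp u u).

Definition ext_angle (R : realType) (u v : 'rV[R]_3) : R :=
  acos (dotp u v / (enorm u * enorm v)).

(* Curves are functions on R of which only the values on [0, 1] matter. *)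

Definition is_curve (R : realType) (C : R -> 'rV[R]_3) : Prop :=
  {within `[0, 1], continuous C}.

Definition closed_curve (R : realType) (C : R -> 'rV[R]_3) : Prop :=
  C 0 = C 1.

Definition simple_curve (R : realType) (C : R -> 'rV[R]_3) : Prop :=
  {in `[0, 1] &, injective C} \/
  (closed_curve C /\ {in `[0, 1[ &, injective C}).

(* Derivatives relative to a set [D], hence one-sided at the endpoints when
   [D] is a closed interval. *)

Definition diff_quot (R : realType) (f : R -> 'rV[R]_3) (t s : R) : 'rV[R]_3 :=
  (s - t)^-1 *: (f s - f t).

Definition derivable_on (R : realType) (D : set R) (f : R -> 'rV[R]_3) : Prop :=
  forall t, D t -> cvg (diff_quot f t @ within D t^').

Definition deriv_on (R : realType) (D : set R) (f : R -> 'rV[R]_3) (t : R)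
    : 'rV[R]_3 :=
  lim (diff_quot f t @ within D t^').

Definition C2_on (R : realType) (D : set R) (f : R -> 'rV[R]_3) : Prop :=
  [/\ derivable_on D f, derivable_on D (deriv_on D f)
    & {within D, continuous (deriv_on D (deriv_on D f))}].

Definition regular_on (R : realType) (D : set R) (f : R -> 'rV[R]_3) : Prop :=
  forall t, D t -> deriv_on D f t != 0.

Definition periodic_ext (R : realType) (C : R -> 'rV[R]_3) (t : R) : 'rV[R]_3 :=
  C (t - (Num.floor t)%:~R).

Definition regular_C2 (R : realType) (C : R -> 'rV[R]_3) : Prop :=
  (~ closed_curve C -> C2_on `[0, 1] C /\ regular_on `[0, 1] C) /\
  (closed_curve C ->
     C2_on setT (periodic_ext C) /\ regular_on setT (periodic_ext C)).

Definition unit_tangent (R : realType) (D : set R) (C : R -> 'rV[R]_3) (t : R)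
    : 'rV[R]_3 :=
  (enorm (deriv_on D C t))^-1 *: deriv_on D C t.

(* |kappa| = |dT/ds| = |T'(t)| / |C'(t)|, since ds = |C'(t)| dt. *)
Definition curvature (R : realType) (D : set R) (C : R -> 'rV[R]_3) (t : R)
    : R :=
  enorm (deriv_on D (unit_tangent D C) t) / enorm (deriv_on D C t).

(* The integral of the curvature of the restriction of [C] to [a, b] against
   its arc length ds = |C'(t)| dt. *)
Definition C2_total_curvature (R : realType) (C : R -> 'rV[R]_3) (a b : R)
    : R :=
  \int[lebesgue_measure]_(t in `[a, b])
    (curvature `[a, b] C t * enorm (deriv_on `[a, b] C t)).

(* [knots] are the parameters of the vertices; at least two of them are forced
   by the conditions on the first and last ones. *)
Record plCurve (R : realType) := PLCurve {
  knots : seq R;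
  plmap :> R -> 'rV[R]_3;
  knots_sorted : sorted <%R knots;
  knots_first : head 0 knots = 0;
  knots_last : last 0 knots = 1;
  plmap_linear : forall j, (j.+1 < size knots)%N ->
    forall s, 0 <= s <= 1 ->
      plmap ((1 - s) * knots`_j + s * knots`_j.+1) =
      (1 - s) *: plmap knots`_j + s *: plmap knots`_j.+1;
  plmap_distinct : forall j, (j.+1 < size knots)%N ->
    plmap knots`_j != plmap knots`_j.+1
}.

Definition inscribed (R : realType) (C : R -> 'rV[R]_3) (L : plCurve R)
    : Prop :=
  forall t, t \in knots L -> L t = C t.

Definition edges (R : realType) (vs : seq 'rV[R]_3) : seq 'rV[R]_3 :=
  pairmap (fun u v => v - u) (head 0 vs) (behead vs).

(* Total curvature of the polygonal line with list of vertices [vs]. *)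
Definition polygon_total_curvature (R : realType) (vs : seq 'rV[R]_3) : R :=
  let es := edges vs in
  \sum_(0 <= j < (size es).-1) ext_angle es`_j es`_j.+1 +
  (if head 0 vs == last 0 vs then ext_angle (last 0 es) (head 0 es) else 0).

(* The vertices of the sub-curve of [L] over [a, b]; these are all the vertices
   of [L] when a = 0 and b = 1. *)
Definition sub_vertices (R : realType) (L : plCurve R) (a b : R)
    : seq 'rV[R]_3 :=
  map L (a :: rcons [seq t <- knots L | a < t < b] b).

Definition pl_total_curvature (R : realType) (L : plCurve R) (a b : R) : R :=
  polygon_total_curvature (sub_vertices L a b).

Definition converges_pointwise (R : realType) (L : nat -> plCurve R)
    (C : R -> 'rV[R]_3) : Prop :=
  forall t : R, 0 <= t <= 1 -> (fun i => L i t) @ \oo --> C t.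

Definition converges_in_total_curvature (R : realType) (L : nat -> plCurve R)
    (C : R -> 'rV[R]_3) : Prop :=
  forall t1 t2 : R, 0 <= t1 -> t1 < t2 -> t2 <= 1 ->
  forall eps : R, 0 < eps ->
  exists N : nat, forall i, (N <= i)%N ->
    `|pl_total_curvature (L i) t1 t2 - C2_total_curvature C t1 t2| < eps.

Definition homeomorphism (T U : topologicalType) (f : T -> U) : Prop :=
  continuous f /\
  exists g : U -> T, [/\ continuous g, cancel f g & cancel g f].

Definition ambient_isotopic (R : realType) (c1 c2 : R -> 'rV[R]_3) : Prop :=
  exists H : 'rV[R]_3 * R -> 'rV[R]_3,
    [/\ {within [set: 'rV[R]_3] `*` `[0, 1], continuous H},
        forall s, 0 <= s <= 1 -> homeomorphism (fun x => H (x, s)),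
        forall x, H (x, 0) = x
      & (fun x => H (x, 1)) @` (c1 @` `[0, 1]) = c2 @` `[0, 1]].

(* Main.v *)
From HB Require Import structures.
Require Import Defs.
From mathcomp Require Import all_boot all_order all_algebra.
From mathcomp Require Import all_classical all_reals all_analysis.
From mathcomp Require Import lra ring.
Import Order.TTheory GRing.Theory Num.Theory.
Import numFieldNormedType.Exports.

Set Implicit Arguments.
Unset Strict Implicit.
Unset Printing Implicit Defensive.

Local Open Scope classical_set_scope.
Local Open Scope ring_scope.

(** The ambient isotopy is explicit: [H (x, s) = x + s *: phi x], where [phi]
    is a map of R^3 into itself with [phi (L t) = C t - L t].  If [phi] is
    Lipschitz with constant [q < 1], every [x |-> x + s *: phi x] is a
    homeomorphism (Banach's fixed point theorem gives the inverse), and time 1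
    carries [L t] to [C t].  Such a [phi] is needed only on the image of [L]:
    a real function on a subset of a metric space extends to the whole space
    with the same Lipschitz constant, and for the sup norm on R^3 this applies
    coordinate by coordinate ([lipschitz_extension],
    [ambient_isotopic_small_displacement]).

    It remains to bound the increments of [C - L] between two parameters by
    half the corresponding chord of [L].  Two estimates give this.

    - [inscribed_difference_lipschitz]: for every [e > 0] and all large [i],
      [C - L_i] is [e]-Lipschitz on [0, 1].  The slope of an edge of [L_i] is a
      mean value of the derivative of [C], so the curves [L_i] are
      equi-Lipschitz and converge uniformly.  On a short edge the slope is close
      to the derivative of [C] by uniform continuity of the latter.  Edges may
      fail to shrink, when [C] has straight portions; on a long edge, uniform
      convergence forces [C] to be nearly affine there, and its derivative is
      again close to the slope of the edge.

    - [chord_arc]: a chord of [C] is at least [c] times the distance of its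
      parameters, measured around the circle when [C] is closed.  Regularity
      gives this near the diagonal, simplicity away from it, and compactness of
      the square of parameters makes [c] uniform.

    Taking [e = c / 3] concludes.  On a closed curve the first estimate also
    holds around the circle, because [C - L_i] vanishes at 0 and 1. *)

(** * Extension of Lipschitz functions *)

(** McShane's formula: the extension is the infimum of the cones
    [x |-> f t + k * `|x - p t|].  Since [f] is [k]-Lipschitz, at [p s] no cone
    goes below [f s], and an infimum of [k]-Lipschitz functions is
    [k]-Lipschitz. *)
Lemma lipschitz_extension (R : realType) (V : normedModType R) (I : Type)
    (S : set I) (p : I -> V) (f : I -> R) (k : R) :
  0 <= k ->
  (forall s t, S s -> S t -> `|f s - f t| <= k * `|p s - p t|) ->
  S !=set0 ->
  exists F : V -> R, (forall x y, `|F x - F y| <= k * `|x - y|) /\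
    forall t, S t -> F (p t) = f t.
Proof.
move=> k0 fk [t0 St0].
pose E x := [set f t + k * `|x - p t| | t in S].
have E0 x : E x !=set0 by exists (f t0 + k * `|x - p t0|), t0.
have lbE x t : S t -> lbound (E x) (f t - k * `|x - p t|).
  move=> St _ [s Ss <-]; have := fk _ _ Ss St; rewrite ler_norml => /andP[+ _].
  have : k * `|p s - p t| <= k * (`|x - p s| + `|x - p t|).
    by rewrite ler_wpM2l// (le_trans (ler_distD x _ _))// (distrC (p s)).
  rewrite mulrDr; lra.
have hE x : has_lbound (E x) by exists (f t0 - k * `|x - p t0|); exact: lbE.
have le_F x y : inf (E x) - inf (E y) <= k * `|x - y|.
  suff : inf (E x) - k * `|x - y| <= inf (E y) by lra.
  apply: lb_le_inf => // _ [t St <-].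
  have : inf (E x) <= f t + k * `|x - p t| by apply: ge_inf => //; exists t.
  have : k * `|x - p t| <= k * (`|x - y| + `|y - p t|).
    by rewrite ler_wpM2l// ler_distD.
  rewrite mulrDr; lra.
exists (fun x => inf (E x)); split=> [x y|t St].
  by rewrite ler_norml le_F andbT lerNl opprB distrC le_F.
apply/eqP; rewrite eq_le; apply/andP; split.
  by apply: ge_inf => //; exists t => //; rewrite subrr normr0 mulr0 addr0.
apply: lb_le_inf => // x Ex.
by have := lbE (p t) t St _ Ex; rewrite subrr normr0 mulr0 subr0.
Qed.

(** * Isotopies from small displacements *)

(** Joins the complete and the normed structures of matrices, so that Banach's
    fixed point theorem applies in R^3. *)
HB.instance Definition _ (R : realType) (m n : nat) :=
  Complete.on 'M[R]_(m, n).

Lemma lipschitz_continuous (R : realType) (V W : normedModType R) (f : V -> W)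
    (k : R) :
  (forall x y, `|f x - f y| <= k * `|x - y|) -> continuous f.
Proof.
move=> fk x; apply/cvgrPdist_lt => e e0; near=> y.
apply: (le_lt_trans (fk _ _)).
have k1 : 0 < `|k| + 1 by rewrite ltr_wpDl.
apply: (@le_lt_trans _ _ ((`|k| + 1) * `|x - y|)).
  by rewrite ler_wpM2r// (le_trans (ler_norm k))// lerDl.
rewrite mulrC -ltr_pdivlMr//; near: y.
by apply/nbhs_normP; exists (e / (`|k| + 1)) => //=; exact: divr_gt0.
Unshelve. all: by end_near. Qed.

(** A perturbation of the identity by a contraction expands distances by at
    least [1 - q], which gives injectivity and a Lipschitz inverse. *)
Lemma homeomorphism_id_add_contraction (R : realType)
    (V : completeNormedModType R) (phi : V -> V) (q : R) :
  0 <= q < 1 -> (forall x y, `|phi x - phi y| <= q * `|x - y|) ->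
  homeomorphism (fun x => x + phi x).
Proof.
move=> /andP[q0 q1] phiq.
have q10 : 0 < 1 - q by rewrite subr_gt0.
have expand x y : (1 - q) * `|x - y| <= `|(x + phi x) - (y + phi y)|.
  have -> : (x + phi x) - (y + phi y) = (x - y) + (phi x - phi y).
    by rewrite opprD addrACA.
  have := phiq x y; have := lerB_normD (x - y) (phi x - phi y); lra.
(* A preimage of [y] is a fixed point of the contraction [x |-> y - phi x]. *)
have surj y : exists x, x + phi x = y.
  pose f := totalfun (fun x => y - phi x).
  have fq : is_contraction f.
    exists (NngNum q0); split=> // -[u v] _ /=.
    by rewrite /totalfun_ opprB addrC addrA subrK distrC.
  have [x _ xE] := banach_fixed_point fq closedT (ex_intro _ y I).
  by exists x; rewrite {1}xE /f /totalfun_ subrK.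
have [g gK] := choice surj.
split.
  move=> x; apply: cvgD; first exact: cvg_id.
  exact: (lipschitz_continuous phiq).
exists g; split=> //.
- apply: (@lipschitz_continuous _ _ _ _ (1 - q)^-1) => y z.
  by rewrite ler_pdivlMl// (le_trans (expand _ _))// !gK.
- move=> x; apply/eqP; rewrite -subr_eq0 -normr_le0.
  have := expand (g (x + phi x)) x; rewrite gK subrr normr0.
  by rewrite pmulr_rle0// subr_gt0.
Qed.

Lemma row_norm_le (R : realType) (n : nat) (x : 'rV[R]_n) (e : R) :
  0 <= e -> (forall k, `|x ord0 k| <= e) -> `|x| <= e.
Proof.
move=> e0 xe; rewrite [leLHS]/Num.Def.normr/= mx_normrE.
by apply: bigmax_le => // -[i k] _ /=; rewrite (ord1 i).
Qed.

Lemma coord_le_row_norm (R : realType) (n : nat) (x : 'rV[R]_n) (k : 'I_n) :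
  `|x ord0 k| <= `|x|.
Proof.
rewrite [leRHS]/Num.Def.normr/= mx_normrE.
by apply: le_trans (le_bigmax_cond _ _ (j := (ord0, k)) _).
Qed.

(** The hypothesis says that [c1 t |-> c2 t - c1 t] is well defined and
    [q]-Lipschitz on the image of [c1].  For the sup norm, its extension
    coordinate by coordinate has the same constant. *)
Lemma ambient_isotopic_small_displacement (R : realType)
    (c1 c2 : R -> 'rV[R]_3) (q : R) :
  0 <= q < 1 ->
  (forall s t, s \in `[0, 1] -> t \in `[0, 1] ->
    `|(c2 s - c1 s) - (c2 t - c1 t)| <= q * `|c1 s - c1 t|) ->
  ambient_isotopic c1 c2.
Proof.
move=> /andP[q0 q1] cq.
have /choice[psi psiP] (k : 'I_3) : exists F : 'rV[R]_3 -> R,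
    (forall x y, `|F x - F y| <= q * `|x - y|) /\
    forall t, t \in `[0, 1] -> F (c1 t) = (c2 t - c1 t) ord0 k.
  apply: (@lipschitz_extension _ _ _ [set` `[0, 1]] c1
    (fun t => (c2 t - c1 t) ord0 k)) => //.
    move=> s t s01 t01; apply: le_trans (cq _ _ s01 t01).
    have := coord_le_row_norm ((c2 s - c1 s) - (c2 t - c1 t)) k.
    by rewrite !mxE.
  by exists 0; rewrite /= in_itv/= lexx ler01.
pose phi x := \row_k psi k x.
have phiq x y : `|phi x - phi y| <= q * `|x - y|.
  apply: row_norm_le => [|k]; first by rewrite mulr_ge0.
  by rewrite !mxE (psiP k).1.
have phiE t : t \in `[0, 1] -> c1 t + phi (c1 t) = c2 t.
  by move=> t01; apply/rowP => k; rewrite !mxE (psiP k).2// !mxE subrKC.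
exists (fun xs => xs.1 + xs.2 *: phi xs.1); split=> [|s /andP[s0 s1]|x|].
- apply: continuous_subspaceT => xs; apply: cvgD; first exact: cvg_fst.
  apply: cvgZ; first exact: cvg_snd.
  apply: continuous_comp; first exact: cvg_fst.
  exact: (lipschitz_continuous phiq).
- apply: (@homeomorphism_id_add_contraction _ _ (fun x => s *: phi x) q).
    by rewrite q0.
  move=> x y; rewrite -scalerBr normrZ ger0_norm//.
  by apply: le_trans (phiq x y); rewrite ler_piMl.
- by rewrite scale0r addr0.
- rewrite image_comp; apply: eq_imagel => t t01 /=.
  by rewrite scale1r phiE.
Qed.

(** * Mean values and continuity of the relative derivative *)

Lemma deriv_on_near (R : realType) (D : set R) (f : R -> 'rV[R]_3) (t e : R) :
  derivable_on D f -> D t -> 0 < e ->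
  \forall s \near t, D s ->
    `|f s - f t - (s - t) *: deriv_on D f t| <= e * `|s - t|.
Proof.
move=> df Dt e0; have /cvgrPdist_le/(_ _ e0) := df t Dt.
rewrite near_withinE near_withinE => near_quot.
near=> s => Ds; have [->|st] := eqVneq s t.
  by rewrite !subrr scale0r subrr !normr0 mulr0.
have st0 : s - t != 0 by rewrite subr_eq0.
have : `|deriv_on D f t - diff_quot f t s| <= e.
  by move: st Ds; near: s.
rewrite distrC => quot_le.
have -> : f s - f t - (s - t) *: deriv_on D f t =
    (s - t) *: (diff_quot f t s - deriv_on D f t).
  by rewrite scalerBr /diff_quot scalerA mulfV// scale1r.
by rewrite normrZ mulrC ler_wpM2r.
Unshelve. all: by end_near. Qed.

Lemma derivable_on_continuous (R : realType) (D : set R) (f : R -> 'rV[R]_3) :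
  derivable_on D f -> {within D, continuous f}.
Proof.
move=> df; apply/subspace_continuousP => t Dt; apply/cvgrPdist_le => e e0.
rewrite near_withinE; set l := deriv_on D f t.
have l1 : 0 < `|l| + 1 by rewrite ltr_wpDl.
near=> s => Ds; rewrite distrC.
have : `|f s - f t - (s - t) *: l| <= 1 * `|s - t|.
  by move: Ds; near: s; exact: deriv_on_near.
have : (`|l| + 1) * `|s - t| <= e.
  rewrite mulrC -ler_pdivlMr// distrC ltW//; near: s.
  by apply/nbhs_normP; exists (e / (`|l| + 1)) => //=; exact: divr_gt0.
have := lerB_dist (f s - f t) ((s - t) *: l); rewrite normrZ; lra.
Unshelve. all: by end_near. Qed.

(** The mean value theorem fails for vectors, but holds for each coordinate,
    with an intermediate point that depends on it.  That point is interior to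
    [D], where the derivative relative to [D] is the ordinary one. *)
Lemma coord_mean_value (R : realType) (D : set R) (f : R -> 'rV[R]_3)
    (k : 'I_3) (a b : R) :
  derivable_on D f -> is_interval D -> D a -> D b -> a < b ->
  exists2 x, a < x < b &
    f b ord0 k - f a ord0 k = deriv_on D f x ord0 k * (b - a).
Proof.
move=> df iD Da Db ab.
have sD : `[a, b] `<=` D.
  by move=> x; rewrite /= in_itv/= => xab; exact: (iD a b).
have [x xab fE] : exists2 x, x \in `]a, b[%R &
    f b ord0 k - f a ord0 k = deriv_on D f x ord0 k * (b - a).
  apply: (MVT (f := fun t => f t ord0 k)
    (df := fun t => deriv_on D f t ord0 k)) => //.
    move=> x xab; set l := deriv_on D f x ord0 k.
    suff qE : (fun h => h^-1 *: (((fun t => f t ord0 k) \o shift x) (h *: 1)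
        - f x ord0 k)) @ 0^' --> l.
      by apply: DeriveDef; [apply/cvg_ex; exists l|exact: cvg_lim].
    apply/cvgrPdist_le => e e0.
    have Dx : D x by exact/sD/subset_itv_oo_cc.
    have near_x : \forall s \near x,
        `|f s - f x - (s - x) *: deriv_on D f x| <= e * `|s - x|.
      near=> s; have Ds : D s.
        by apply/sD/subset_itv_oo_cc; near: s; exact: near_in_itvoo.
      by move: Ds; near: s; exact: deriv_on_near.
    have /nbhs0P near_0 := near_x.
    near=> h; have h0 : h != 0 by near: h; exact: nbhs_dnbhs_neq.
    have := coord_le_row_norm
      (f (x + h) - f x - (x + h - x) *: deriv_on D f x) k.
    have : `|f (x + h) - f x - (x + h - x) *: deriv_on D f x|
        <= e * `|x + h - x|.
      by near: h; exact: nbhs_dnbhs.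
    rewrite /= !mxE -/l [x + h]addrC addrK [h *: 1]mulr1 => le1 le2.
    have -> : l - h^-1 *: (f (h + x) ord0 k - f x ord0 k) =
        - (h^-1 * (f (h + x) ord0 k - f x ord0 k - h * l)).
      by rewrite mulrBr mulKf// opprB.
    rewrite normrN normrM normfV ler_pdivrMl ?normr_gt0// [`|h| * e]mulrC.
    exact: le_trans le2 le1.
  apply: continuous_subspaceW sD _.
  have /subspace_continuousP cf := derivable_on_continuous df.
  apply/subspace_continuousP => x Dx.
  apply: (cvg_comp f (fun M : 'rV[R]_3 => M ord0 k) (cf x Dx)).
  exact: coord_continuous.
by exists x; rewrite // -in_itv.
Unshelve. all: by end_near. Qed.

(** * Compactness and uniform continuity *)

(** Uniform continuity, uniform convergence and the chord-arc bound all reduce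
    to this form of compactness, applied to different [P] and [A]. *)
Lemma compact_uniform_radius (R : realType) (V : normedModType R) (A : set V)
    (P : R -> V -> Prop) :
  compact A ->
  (forall x, A x -> exists2 r, 0 < r &
    forall y d, A y -> `|x - y| < r -> 0 < d < r -> P d y) ->
  exists2 d, 0 < d & forall x, A x -> P d x.
Proof.
move=> /compact_near_coveringP/near_covering_withinP cover locP.
have near_d : \forall d \near (0 : R)^'+, A `<=` P d.
  apply: cover => x Ax; have [r r0 rP] := locP x Ax.
  exists (ball_ Num.norm x r, [set d | 0 < d < r]) => /=.
    split; first by apply/nbhs_normP; exists r.
    near=> d; apply/andP; split; near: d.
      exact: nbhs_right_gt.
    exact: nbhs_right_lt.
  by move=> [y d] /= [xy dr] Ay; exact: rP.
near (0 : R)^'+ => d; exists d => // x Ax.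
by apply: (near near_d d).
Unshelve. all: by end_near. Qed.

Lemma within_continuous_dist (R : realType) (V : normedModType R) (A : set R)
    (g : R -> V) (x e : R) :
  {within A, continuous g} -> A x -> 0 < e ->
  exists2 r, 0 < r & forall y, A y -> `|x - y| < r -> `|g x - g y| <= e.
Proof.
move=> /subspace_continuousP cg Ax e0.
have /cvgrPdist_le/(_ _ e0) := cg x Ax.
rewrite near_withinE => /nbhs_normP[r /= r0 gr].
by exists r => // y Ay xy; exact: gr.
Qed.

Lemma segment_unif_continuous (R : realType) (V : normedModType R)
    (g : R -> V) (a b e : R) :
  {within `[a, b], continuous g} -> 0 < e ->
  exists2 d, 0 < d & forall s t, a <= s <= b -> a <= t <= b ->
    `|s - t| <= d -> `|g s - g t| <= e.
Proof.
move=> cg e0.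
have loc (x : R) : `[a, b]%classic x -> exists2 r, 0 < r &
    forall y d : R, `[a, b]%classic y -> `|x - y| < r -> 0 < d < r ->
    forall t, a <= t <= b -> `|y - t| <= d -> `|g y - g t| <= e.
  move=> xab; have e20 : 0 < e / 2 by rewrite divr_gt0.
  have [r r0 gr] := within_continuous_dist cg xab e20.
  exists (r / 2) => [|y d yab xy /andP[d0 dr] t tab yt]; first by lra.
  have gy : `|g x - g y| <= e / 2 by apply: gr => //; lra.
  have gt : `|g x - g t| <= e / 2.
    by apply: gr; rewrite /= ?in_itv//=; have := ler_distD y x t; lra.
  by have := ler_distD (g x) (g y) (g t); rewrite (distrC (g y) (g x)); lra.
have [d d0 gd] := compact_uniform_radius (@segment_compact R a b) loc.
by exists d => // s t sab; apply: gd; rewrite /= in_itv.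
Qed.

(** * Polygonal approximation with derivatives *)

(** [g] is a derivative of [C], as far as the mean value theorem can tell.  This
    is the only use of differentiability in the approximation, and it asks for
    no convention at the endpoints or at the closing point. *)
Definition has_slope (R : realType) (C g : R -> 'rV[R]_3) : Prop :=
  forall (k : 'I_3) a b, 0 <= a -> a < b -> b <= 1 ->
  exists2 x, a < x < b & C b ord0 k - C a ord0 k = g x ord0 k * (b - a).

(** Lipschitz estimates with the same constant on adjacent intervals add up. *)
Lemma lipschitz_path (R : realType) (V : normedModType R) (f : R -> V)
    (K x : R) (s : seq R) :
  path <%R x s ->
  (forall j, (j < size s)%N -> forall u v, nth 0 (x :: s) j <= u -> u <= v ->
    v <= nth 0 s j -> `|f v - f u| <= K * (v - u)) ->
  forall u v, x <= u -> u <= v -> v <= last x s -> `|f v - f u| <= K * (v - u).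
Proof.
elim: s x => [|y s IH] x /=.
  move=> _ _ u v xu uv vx; have -> : u = v by lra.
  by rewrite !subrr normr0 mulr0.
move=> /andP[xy ys] fK u v xu uv vl.
have fK0 := fK 0%N isT; have fKS j := fK j.+1.
have [vy|yv] := leP v y; first exact: fK0.
have [yu|uy] := leP y u; first exact: (IH y).
have f1 : `|f y - f u| <= K * (y - u) by apply: fK0; rewrite // ltW.
have f2 : `|f v - f y| <= K * (v - y) by apply: (IH y) => //; rewrite ltW.
have := ler_distD (f y) (f v) (f u); lra.
Qed.

Lemma pl_lipschitz (R : realType) (L : plCurve R) (V : normedModType R)
    (f : R -> V) (K : R) :
  (forall j, (j.+1 < size (knots L))%N ->
    0 <= (knots L)`_j -> (knots L)`_j < (knots L)`_j.+1 ->
    (knots L)`_j.+1 <= 1 ->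
    forall u v, (knots L)`_j <= u -> u <= v -> v <= (knots L)`_j.+1 ->
    `|f v - f u| <= K * (v - u)) ->
  forall u v, 0 <= u -> u <= v -> v <= 1 -> `|f v - f u| <= K * (v - u).
Proof.
have := knots_sorted L; have := knots_first L; have := knots_last L.
case: (knots L) => [/= /eqP|x s /= last1 x0]; first by rewrite eq_sym oner_eq0.
rewrite x0 in last1 * => sorted_s fK u v u0 uv v1.
apply: (@lipschitz_path _ _ f K 0 s) => //; last by rewrite last1.
(* [0 :: s] is the list of knots: the last one has index [size s]. *)
have mono (i j : nat) : (i <= j)%N -> (j < (size s).+1)%N ->
    nth 0 (0 :: s) i <= nth 0 (0 :: s) j.
  move=> ij js; rewrite (@lt_sorted_leq_nth _ _ 0 (0 :: s))//.
  by rewrite inE /= (leq_ltn_trans ij).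
move=> j js; apply: fK => //.
- by apply: (mono 0%N) => //; rewrite ltnW.
- by rewrite (@lt_sorted_ltn_nth _ _ 0 (0 :: s) _ j j.+1)// inE /= ltnS ltnW.
- have := mono j.+1 (size s) js (ltnSn _).
  by rewrite [nth 0 (0 :: s) (size s)](nth_last 0 (0 :: s)) /= last1.
Qed.

Lemma pl_edgeE (R : realType) (C : R -> 'rV[R]_3) (L : plCurve R) (j : nat)
    (u v : R) (a := (knots L)`_j) (b := (knots L)`_j.+1) :
  inscribed C L -> (j.+1 < size (knots L))%N -> a < b ->
  a <= u -> u <= v -> v <= b ->
  L v - L u = (v - u) *: ((b - a)^-1 *: (C b - C a)).
Proof.
move=> insC js ab au uv vb; have ba0 : b - a != 0 by rewrite subr_eq0 gt_eqF.
have LE w : a <= w -> w <= b ->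
    L w = C a + ((w - a) / (b - a)) *: (C b - C a).
  move=> aw wb; set s := (w - a) / (b - a).
  have s01 : 0 <= s <= 1.
    rewrite /s divr_ge0 ?subr_ge0//; last exact: ltW.
    by rewrite ler_pdivrMr ?subr_gt0// mul1r lerD2r.
  have wE : w = (1 - s) * a + s * b by rewrite /s; field.
  rewrite {1}wE (plmap_linear js s01) -/a -/b.
  have -> : L a = C a by apply: insC; rewrite mem_nth// ltnW.
  have -> : L b = C b by apply: insC; rewrite mem_nth.
  by rewrite scalerBl scale1r scalerBr addrAC addrA.
have av : a <= v by lra.
have ub : u <= b by lra.
rewrite (LE v)// (LE u)//.
rewrite opprD addrACA subrr add0r -scalerBl scalerA; congr (_ *: _); field.
exact: ba0.
Qed.

Lemma has_slope_lipschitz (R : realType) (C g : R -> 'rV[R]_3) (K : R) :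
  has_slope C g -> (forall t, 0 <= t <= 1 -> `|g t| <= K) ->
  forall u v, 0 <= u -> u <= v -> v <= 1 -> `|C v - C u| <= K * (v - u).
Proof.
move=> Cg gK u v u0 uv v1.
have K0 : 0 <= K by apply: le_trans (gK 0 _); rewrite ?lexx ?ler01.
have [<-|uv'] := eqVneq u v; first by rewrite !subrr normr0 mulr0.
apply: row_norm_le => [|k]; first by rewrite mulr_ge0 ?subr_ge0.
have ltuv : u < v by rewrite lt_neqAle uv'.
rewrite !mxE; have [x /andP[ux xv] ->] := Cg k u v u0 ltuv v1.
rewrite normrM [`|v - u|]ger0_norm ?subr_ge0// ler_wpM2r ?subr_ge0//.
by apply: le_trans (coord_le_row_norm _ _) _; apply: gK; lra.
Qed.

(** The slope of an edge is that of a chord of [C]. *)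
Lemma inscribed_lipschitz (R : realType) (C : R -> 'rV[R]_3) (K : R)
    (L : plCurve R) :
  (forall u v, 0 <= u -> u <= v -> v <= 1 -> `|C v - C u| <= K * (v - u)) ->
  inscribed C L ->
  forall u v, 0 <= u -> u <= v -> v <= 1 -> `|L v - L u| <= K * (v - u).
Proof.
move=> CK insC; apply: (@pl_lipschitz _ L) => j js.
set a := (knots L)`_j; set b := (knots L)`_j.+1 => a0 ab b1 u v au uv vb.
rewrite (pl_edgeE insC js ab au uv vb) -/a -/b normrZ normrZ normfV.
have ba : 0 < b - a by rewrite subr_gt0.
rewrite [`|v - u|]ger0_norm ?subr_ge0// [`|b - a|]gtr0_norm//.
rewrite mulrC ler_wpM2r ?subr_ge0// ler_pdivrMl// mulrC.
by apply: CK => //; exact: ltW.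
Qed.

(** Equicontinuity turns pointwise convergence into uniform convergence on the
    segment. *)
Lemma lipschitz_pointwise_uniform (R : realType) (V : normedModType R)
    (fs : nat -> R -> V) (f : R -> V) (K e : R) :
  (forall i, (0 < i)%N -> forall u v, 0 <= u -> u <= v -> v <= 1 ->
    `|fs i v - fs i u| <= K * (v - u)) ->
  (forall u v, 0 <= u -> u <= v -> v <= 1 -> `|f v - f u| <= K * (v - u)) ->
  (forall t, 0 <= t <= 1 -> (fun i => fs i t) @ \oo --> f t) ->
  0 < e ->
  exists N, forall i, (N < i)%N -> forall t, 0 <= t <= 1 ->
    `|fs i t - f t| <= e.
Proof.
move=> fsK fK cv e0.
have dist (h : R -> V) : (forall u v, 0 <= u -> u <= v -> v <= 1 ->
    `|h v - h u| <= K * (v - u)) ->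
    forall u v, 0 <= u <= 1 -> 0 <= v <= 1 -> `|h v - h u| <= K * `|v - u|.
  move=> hK u v /andP[u0 u1] /andP[v0 v1]; have [uv|/ltW vu] := leP u v.
    by rewrite [`|v - u|]ger0_norm ?subr_ge0// hK.
  by rewrite distrC [`|v - u|]distrC [`|u - v|]ger0_norm ?subr_ge0// hK.
have K0 : 0 <= K.
  have := fK 0 1 (lexx _) ler01 (lexx _); rewrite subr0 mulr1.
  exact: le_trans.
(* The uniform radius [d] encodes a rank: [1 <= i * d] says that [i] is past
   [1 / d], and [d < 1 / N.+1] then forces [N < i]. *)
have loc (x : R) : `[0, 1]%classic x -> exists2 r, 0 < r &
    forall y d : R, `[0, 1]%classic y -> `|x - y| < r -> 0 < d < r ->
    forall i, 1 <= i%:R * d -> `|fs i y - f y| <= e.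
  rewrite /= in_itv/= => x01; have e30 : 0 < e / 3 by rewrite divr_gt0.
  have /cvgrPdist_le/(_ _ e30)[N _ fsN] := cv x x01.
  have K1 : 0 < K + 1 by rewrite ltr_wpDl.
  pose r := Num.min (e / 3 / (K + 1)) (N.+1%:R)^-1.
  exists r => [|y d]; first by rewrite lt_min !divr_gt0// invr_gt0 ltr0n.
  rewrite in_itv /= => y01; rewrite lt_min => /andP[xy _] /andP[d0].
  rewrite lt_min => /andP[_ dN] i id.
  have Ni : (N.+1 <= i)%N.
    rewrite -(ler_nat R) -[leLHS]mul1r -ler_pdivlMr ?ltr0n//.
    by apply: le_trans id _; rewrite ler_wpM2l// ltW.
  have i0 : (0 < i)%N by exact: leq_trans Ni.
  have fsx : `|f x - fs i x| <= e / 3 by apply: fsN; rewrite /= ltnW.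
  have Kxy : K * `|x - y| <= e / 3.
    apply: (@le_trans _ _ ((K + 1) * `|x - y|)).
      by rewrite ler_wpM2r// lerDl.
    by rewrite mulrC -ler_pdivlMr// ltW.
  have fsy := dist _ (fsK i i0) y x y01 x01.
  have fy := dist _ fK y x y01 x01.
  have := ler_distD (f x) (f y) (fs i y).
  have := ler_distD (fs i x) (f x) (fs i y).
  rewrite (distrC (f y) (f x)) (distrC (f y) (fs i y)); lra.
have [d d0 unif] := compact_uniform_radius (@segment_compact R 0 1) loc.
exists (Num.trunc d^-1).+1 => i iN t t01.
apply: unif; first by rewrite /= in_itv.
rewrite -ler_pdivrMr// mul1r.
apply: (le_trans (ltW (truncnS_gt _))); rewrite ler_nat; exact: ltnW.
Qed.

(** Short and long edges are treated differently, because pointwise convergence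
    does not make the mesh of the knots small.  On an edge no longer than [d],
    each coordinate of the slope is a value of that of [g] near [r].  Otherwise
    the chord of [C] on an interval of length [d] around [r] has the slope of
    the edge, up to the distance from [L] to [C]. *)
Lemma mean_slope_close (R : realType) (C g : R -> 'rV[R]_3) (L : plCurve R)
    (j : nat) (d e : R) (a := (knots L)`_j) (b := (knots L)`_j.+1) :
  has_slope C g -> 0 < d -> 0 < e ->
  (forall s t, 0 <= s <= 1 -> 0 <= t <= 1 -> `|s - t| <= d ->
    `|g s - g t| <= e / 2) ->
  (forall t, 0 <= t <= 1 -> `|L t - C t| <= d * e / 4) ->
  inscribed C L -> (j.+1 < size (knots L))%N -> 0 <= a -> a < b -> b <= 1 ->
  forall r k, a <= r <= b ->
    `|((b - a)^-1 *: (C b - C a)) ord0 k - g r ord0 k| <= e.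
Proof.
move=> Cg d0 e0 gd LC insC js a0 ab b1 r k rab.
set m := (b - a)^-1 *: _; have ba0 : 0 < b - a by rewrite subr_gt0.
have gk x : 0 <= x <= 1 -> `|x - r| <= d ->
    `|g x ord0 k - g r ord0 k| <= e / 2.
  move=> x01 xr; have := coord_le_row_norm (g x - g r) k; rewrite !mxE.
  by move/le_trans; apply; apply: gd => //; lra.
have [bad|dba] := leP (b - a) d.
  have [x xab xE] := Cg k a b a0 ab b1.
  have -> : m ord0 k = g x ord0 k.
    by rewrite !mxE xE mulrC mulfK// gt_eqF.
  apply: le_trans (gk x _ _) _; first lra; last lra.
  by rewrite ler_norml; lra.
(* On a long edge, compare with the chord of parameter length exactly [d]
   around [r]; it is shifted left when [r + d] would leave the edge. *)
pose u := Num.min r (b - d); pose v := u + d.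
have [au ur rv vb] : [/\ a <= u, u <= r, r <= v & v <= b].
  by rewrite /v /u; case: (leP r (b - d)) => ?; split; lra.
have uv : u < v by rewrite /v; lra.
have u0 : 0 <= u by lra.
have v1 : v <= 1 by lra.
have [x xuv xE] := Cg k u v u0 uv v1.
have := pl_edgeE insC js ab au (ltW uv) vb; rewrite -/a -/b -/m => LE.
have vud : v - u = d by rewrite /v; lra.
have coordLC t : 0 <= t <= 1 -> `|L t ord0 k - C t ord0 k| <= d * e / 4.
  move=> t01; have := coord_le_row_norm (L t - C t) k; rewrite !mxE.
  by move/le_trans; apply; exact: LC.
have LEk : L v ord0 k - L u ord0 k = d * m ord0 k.
  by have := congr1 (fun M : 'rV[R]_3 => M ord0 k) LE; rewrite vud !mxE.
(* Replacing [C] by [L] at both ends of the chord costs [2 * (d * e / 4)],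
   hence [e / 2] in the slope. *)
have mx : `|m ord0 k - g x ord0 k| <= e / 2.
  have xE' : d * g x ord0 k = C v ord0 k - C u ord0 k by rewrite xE vud mulrC.
  rewrite -(ler_pM2l d0) -{1}(gtr0_norm d0) -normrM mulrBr -LEk xE'.
  have v01 : 0 <= v <= 1 by lra.
  have u01 : 0 <= u <= 1 by lra.
  by have := coordLC v v01; have := coordLC u u01; rewrite !ler_norml; lra.
have gx : `|g x ord0 k - g r ord0 k| <= e / 2.
  by apply: gk; rewrite ?ler_norml; lra.
by have := ler_distD (g x ord0 k) (m ord0 k) (g r ord0 k); lra.
Qed.

(** Integrating the closeness of the slopes along each edge, by means of the
    mean value theorem on each coordinate. *)
Lemma inscribed_difference_lipschitz (R : realType) (C g : R -> 'rV[R]_3)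
    (L : nat -> plCurve R) (e : R) :
  has_slope C g -> {within `[0, 1], continuous g} ->
  (forall i, (0 < i)%N -> inscribed C (L i)) -> converges_pointwise L C ->
  0 < e ->
  exists N, forall i, (N < i)%N ->
    forall u v, 0 <= u -> u <= v -> v <= 1 ->
    `|(C v - L i v) - (C u - L i u)| <= e * (v - u).
Proof.
move=> Cg cg insC LC e0.
have [K gK] : exists K, forall t, 0 <= t <= 1 -> `|g t| <= K.
  have cng : {within `[0, 1], continuous (fun t => `|g t|)}.
    move=> t; apply: continuous_comp; [exact: cg|exact: norm_continuous].
  have [c _ gc] := EVT_max (@ler01 R) cng.
  by exists `|g c| => t t01; apply: gc; rewrite in_itv.
have CK := has_slope_lipschitz Cg gK.
have e20 : 0 < e / 2 by rewrite divr_gt0.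
have [d d0 gd] := segment_unif_continuous cg e20.
have [|N LN] := lipschitz_pointwise_uniform (e := d * e / 4)
  (fun i i0 => inscribed_lipschitz CK (insC i i0)) CK LC.
  by rewrite divr_gt0// mulr_gt0.
exists N => i Ni; have i0 : (0 < i)%N by exact: leq_ltn_trans Ni.
apply: (@pl_lipschitz _ (L i) _ (fun t => C t - L i t)) => j js.
set a := (knots (L i))`_j; set b := (knots (L i))`_j.+1.
move=> a0 ab b1 u v au uv vb.
have [<-|uv'] := eqVneq u v; first by rewrite !subrr normr0 mulr0.
have ltuv : u < v by rewrite lt_neqAle uv'.
apply: row_norm_le => [|k]; first by rewrite mulr_ge0 ?subr_ge0// ltW.
have [||x xuv xE] := Cg k u v _ ltuv _; [lra|lra|].
have xab : a <= x <= b by lra.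
have := mean_slope_close Cg d0 e0 gd (LN i Ni) (insC i i0) js a0 ab b1 k xab.
have LE := pl_edgeE (insC i i0) js ab au uv vb.
have := congr1 (fun M : 'rV[R]_3 => M ord0 k) LE; rewrite -/a -/b.
set m := (b - a)^-1 *: _ => {}LE.
rewrite distrC => le_e; rewrite -(gtr0_norm (x := v - u)) ?subr_gt0//.
have -> : ((C v - L i v) - (C u - L i u)) ord0 k =
    (g x ord0 k - m ord0 k) * (v - u).
  rewrite mulrBl -xE; move: LE; rewrite !mxE; lra.
by rewrite normrM ler_wpM2r.
Qed.

(** * Chords and arcs of a simple regular curve *)

(** Treats open and closed curves alike: [f] is [C] itself in the first case
    and its periodic extension in the second, which makes sense of the curve on
    both sides of the closing point. *)
Lemma regular_C2_extension (R : realType) (C : R -> 'rV[R]_3) :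
  regular_C2 C -> exists (D : set R) (f : R -> 'rV[R]_3),
  [/\ is_interval D /\ `[0, 1] `<=` D,
      forall t, 0 <= t <= 1 -> f t = C t,
      derivable_on D f /\ derivable_on D (deriv_on D f),
      regular_on D f
    & closed_curve C -> D = setT /\ forall t, f (t + 1) = f t].
Proof.
move=> [openC closedC]; have [cC|oC] := pselect (closed_curve C).
  have [[df ddf _] rf] := closedC cC.
  exists setT, (periodic_ext C); split=> // [t t01|_].
    rewrite /periodic_ext; have [->|t1] := eqVneq t 1.
      by rewrite floor1 subrr cC.
    rewrite (floor_def (m := 0)) ?subr0//.
    by case/andP: t01 => -> t1'; rewrite add0r lt_neqAle t1.
  split=> // t; rewrite /periodic_ext floorDrz ?rpred1// floor1 intrD.
  by congr C; ring.
have [[df ddf _] rf] := openC oC.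
exists `[0, 1]%classic, C; split=> //; split=> // x y /=.
by rewrite !in_itv/= => x01 y01 z xyz; rewrite in_itv/=; lra.
Qed.

(** A coordinate of the derivative that does not vanish at [x] stays away from 0
    near [x], so that this coordinate of [f] alone separates points. *)
Lemma immersion_locally_expanding (R : realType) (D : set R)
    (f : R -> 'rV[R]_3) (x : R) :
  is_interval D -> derivable_on D f -> derivable_on D (deriv_on D f) ->
  D x -> deriv_on D f x != 0 ->
  exists c r, [/\ 0 < c, 0 < r & forall s t, D s -> D t -> `|x - s| < r ->
    `|x - t| < r -> s <= t -> c * (t - s) <= `|f t - f s|].
Proof.
move=> iD df ddf Dx gx0; set g := deriv_on D f in ddf gx0 *.
have [k gxk] : exists k, g x ord0 k != 0.
  apply/existsP; move: gx0; apply: contraNT; rewrite negb_exists => /forallP gk.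
  by apply/eqP/rowP => k; rewrite mxE; apply/eqP/negPn/gk.
have c0 : 0 < `|g x ord0 k| / 2 by rewrite divr_gt0 ?normr_gt0.
have [r r0 gr] := within_continuous_dist (derivable_on_continuous ddf) Dx c0.
exists (`|g x ord0 k| / 2), r; split=> // s t Ds Dt xs xt.
rewrite le_eqVlt => /predU1P[->|st]; first by rewrite !subrr mulr0 normr_ge0.
have [y yst yE] := coord_mean_value k df iD Ds Dt st.
have Dy : D y by apply: (iD s t) => //; case/andP: yst => /ltW -> /ltW ->.
have xy : `|x - y| < r by move: xs xt; rewrite !ltr_norml; lra.
apply: le_trans (coord_le_row_norm (f t - f s) k); rewrite !mxE yE normrM.
rewrite [`|t - s|]gtr0_norm ?subr_gt0// ler_pM2r ?subr_gt0//.
have := coord_le_row_norm (g x - g y) k; have := gr y Dy xy; rewrite !mxE.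
have := ler_distD (g y ord0 k) (g x ord0 k) 0; rewrite !subr0 -/g; lra.
Qed.

(** The second alternative is the estimate along the arc through the closing
    point, whose parameter length is [1 - (t - s)]. *)
Lemma chord_arc (R : realType) (C : R -> 'rV[R]_3) :
  is_curve C -> regular_C2 C -> simple_curve C ->
  exists2 c, 0 < c & forall s t, 0 <= s -> s <= t -> t <= 1 ->
    c * (t - s) <= `|C t - C s| \/
    closed_curve C /\ c * (1 - (t - s)) <= `|C t - C s|.
Proof.
move=> cC /regular_C2_extension[D [f [[iD sD] fC [df ddf] rf perf]]] simpleC.
pose P (c : R) (st : R * R) := st.1 <= st.2 ->
    c * (st.2 - st.1) <= `|C st.2 - C st.1| \/
    closed_curve C /\ c * (1 - (st.2 - st.1)) <= `|C st.2 - C st.1|.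
have loc (x : R * R) : (`[0, 1] `*` `[0, 1]) x -> exists2 r, 0 < r &
    forall y d, (`[0, 1] `*` `[0, 1]) y -> `|x - y| < r -> 0 < d < r -> P d y.
  case: x => s0 t0 [/= s01 t01].
  have box (r s t : R) :
      `|(s0, t0) - (s, t)| < r -> `|s0 - s| < r /\ `|t0 - t| < r.
    by rewrite prod_normE gt_max => /andP.
  have [Cst|Cst] := eqVneq (C s0) (C t0); last first.
    (* Distinct images stay apart, and [t - s <= 1]. *)
    set mu := `|C t0 - C s0|.
    have mu0 : 0 < mu by rewrite normr_gt0 subr_eq0 eq_sym.
    have mu4 : 0 < mu / 4 by rewrite divr_gt0.
    have [r1 r10 Cr1] := within_continuous_dist cC s01 mu4.
    have [r2 r20 Cr2] := within_continuous_dist cC t01 mu4.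
    exists (Num.min (Num.min r1 r2) (mu / 2)).
      by rewrite !lt_min r10 r20 divr_gt0.
    move=> [s t] d [/= s1 t1] /box[]; rewrite !lt_min => /andP[/andP[sr _] _].
    move=> /andP[/andP[_ tr] _] /and3P[d0 _ dmu] st; left=> /=.
    move: s1 t1; rewrite !in_itv/= => s1 t1.
    have := Cr1 s s1 sr; have := Cr2 t t1 tr.
    have := ler_distD (C t) (C t0) (C s0); have := ler_distD (C s) (C t) (C s0).
    have : d * (t - s) <= d by rewrite ler_piMr ?(ltW d0)//; lra.
    rewrite (distrC (C s)) -/mu; lra.
  have [s0t0|s0t0] := eqVneq s0 t0.
    have [c [r [c0 r0 fr]]] :=
      immersion_locally_expanding iD df ddf (sD _ s01) (rf _ (sD _ s01)).
    exists (Num.min c r); first by rewrite lt_min c0.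
    move=> [s t] d [/= s1 t1] /box[]; rewrite !lt_min => /andP[_ sr].
    move=> /andP[_ tr] /and3P[d0 dc _] st; left=> /=; rewrite -s0t0 in tr.
    have := fr s t (sD _ s1) (sD _ t1) sr tr st.
    move: s1 t1; rewrite /= !in_itv/= => s1 t1; rewrite !fC//.
    by apply: le_trans; rewrite ler_wpM2r ?subr_ge0// ltW.
  (* What remains is a closed curve seen at the two ends of [0, 1]. *)
  case: simpleC => [injC|[clC injC]].
    by case/eqP: s0t0; apply: injC; rewrite ?inE.
  have [_ perf1] := perf clC.
  have inj0 x : x \in `[0, 1] -> x != 1 -> x \in `[0, 1[.
    by rewrite !in_itv/= lt_neqAle => /andP[-> ->] ->.
  have i0 : (0 : R) \in `[0, 1[ by rewrite in_itv/= lexx ltr01.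
  have [s1|s1] := eqVneq s0 1.
    have t1 : t0 != 1 by rewrite -s1 eq_sym.
    have t0E : t0 = 0.
      by apply: injC => //; [exact: inj0|rewrite -Cst s1 -clC].
    (* Near the corner [(1, 0)] no pair satisfies [s <= t]. *)
    exists (1 / 2) => [|[s t] d _ /box[]]; first by lra.
    by rewrite s1 t0E /P /= !ltr_norml; lra.
  have t1 : t0 = 1.
    apply: contraNeq s0t0 => t1; apply/eqP.
    by apply: injC => //; exact: inj0.
  have s0E : s0 = 0.
    by apply: injC => //; [exact: inj0|rewrite Cst t1 -clC].
  (* Near the corner [(0, 1)], replace [s] by [s + 1], on the same side as [t]:
     the arc from [t] to [s + 1] passes through the closing point. *)
  have D1 : D 1 by apply: sD; rewrite /= in_itv/= ler01 lexx.
  have [c [r [c0 r0 fr]]] := immersion_locally_expanding iD df ddf D1 (rf _ D1).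
  exists (Num.min c r); first by rewrite lt_min c0.
  move=> [s t] d [/= s01' t01'] /box[]; rewrite !lt_min => /andP[_ sr].
  move=> /andP[_ tr] /and3P[d0 dc _] st; right=> /=; split=> //.
  have Ds1 : D (s + 1) by rewrite (perf clC).1.
  rewrite t1 in tr; have s1r : `|1 - (s + 1)| < r.
    by move: sr; rewrite s0E opprD addrCA subrr addr0 sub0r.
  move: (s01') (t01'); rewrite !in_itv/= => s01i t01i.
  have ts1 : t <= s + 1 by lra.
  have := fr t (s + 1) (sD _ t01') Ds1 tr s1r ts1.
  rewrite perf1 !fC// [`|C s - C t|]distrC; apply: le_trans.
  have -> : 1 - (t - s) = s + 1 - t by ring.
  by rewrite ler_wpM2r ?subr_ge0// ltW.
have compact_sq : compact (`[0 : R, 1] `*` `[0 : R, 1]).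
  by apply: compact_setX; exact: segment_compact.
have [c c0 Pc] := compact_uniform_radius compact_sq loc.
exists c => // s t s0 st t1.
by apply: (Pc (s, t)) => //=; rewrite !in_itv/=; split; lra.
Qed.

(** * The isotopy *)

Lemma pl_end_knots (R : realType) (L : plCurve R) :
  (0 \in knots L) /\ (1 \in knots L).
Proof.
have := knots_first L; have := knots_last L.
case: (knots L) => [/= /eqP|x s /= <- {1}<-]; first by rewrite eq_sym oner_eq0.
by rewrite mem_head mem_last.
Qed.

Theorem theorem4p6 (R : realType) (C : R -> 'rV[R]_3) (L : nat -> plCurve R)
    (hcurve : is_curve C) (hC2 : regular_C2 C) (hsimple : simple_curve C)
    (hins : forall i : nat, (0 < i)%N -> inscribed C (L i))
    (hpt : converges_pointwise L C)
    (htc : converges_in_total_curvature L C) :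
  exists N : nat, (0 < N)%N /\
    forall i : nat, (N < i)%N -> ambient_isotopic (L i) C.
Proof.
have [c c0 arcC] := chord_arc hcurve hC2 hsimple.
have [D [f [[iD sD] fC [df ddf] _ _]]] := regular_C2_extension hC2.
have slopeC : has_slope C (deriv_on D f).
  move=> k a b a0 ab b1; rewrite -!fC; [|lra|lra].
  by apply: coord_mean_value => //; apply: sD; rewrite /= in_itv/=; lra.
have cg : {within `[0, 1], continuous (deriv_on D f)}.
  by apply: continuous_subspaceW sD _; exact: derivable_on_continuous.
(* With displacement at most [c / 3] times arc length, a displacement is at
   most 1/3 of the chord of [C], hence at most 1/2 of the chord of [L i]. *)
have c30 : 0 < c / 3 by rewrite divr_gt0.
have [N LN] := inscribed_difference_lipschitz slopeC cg hins hpt c30.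
exists N.+1; split=> // i Ni; have i0 : (0 < i)%N by exact: leq_ltn_trans Ni.
have {LN} diff_le := LN i (ltnW Ni).
have [k0 k1] := pl_end_knots (L i).
have L0 : L i 0 = C 0 by exact: hins.
have L1 : L i 1 = C 1 by exact: hins.
have small u v : 0 <= u -> u <= v -> v <= 1 ->
    `|(C v - L i v) - (C u - L i u)| <= 1 / 2 * `|L i v - L i u|.
  move=> u0 uv v1.
  set d := (C v - L i v) - (C u - L i u).
  have d3 : 3 * `|d| <= `|C v - C u|.
    case: (arcC u v u0 uv v1) => [|[_]].
      by have := diff_le u v u0 uv v1; rewrite -/d; lra.
    (* Both curves agree at 0 and 1, so the displacement can be estimated
       along the complementary arc. *)
    have := diff_le 0 u (lexx _) u0 (le_trans uv v1).
    have := diff_le v 1 (le_trans u0 uv) v1 (lexx _).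
    rewrite L0 L1 !subrr subr0 sub0r normrN.
    have := ler_normB (C v - L i v) (C u - L i u); rewrite -/d; lra.
  have -> : L i v - L i u = (C v - C u) - d.
    by apply/rowP => k; rewrite !mxE; ring.
  have := lerB_normD (C v - C u) (- d); rewrite normrN; lra.
apply: (@ambient_isotopic_small_displacement _ _ _ (1 / 2)) => [|s t].
  lra.
rewrite !in_itv/= => s01 t01; have [ts|/ltW st] := leP t s.
  by apply: small; lra.
by rewrite distrC [`|L i s - _|]distrC; apply: small; lra.
Qed.
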